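(* $M(7,4)\le 535$. That is, every set $\Gamma$ of permutations of $\{1,\dots,7\}$ in which any two distinct elements $\phi,\psi$ satisfy $d_H(\phi,\psi)\ge 4$ has at most $535$ elements.
   Context: For permutations $\phi,\psi\in\mathrm{Sym}(n)$, the Hamming distance $d_H(\phi,\psi)$ is the number of non-fixed points of $\phi\psi^{-1}$, equivalently the number of $x\in\{1,\dots,n\}$ with $\phi(x)\ne\psi(x)$. $M(n,d)$ denotes the maximum size of a subset $\Gamma\subseteq\mathrm{Sym}(n)$ such that $d_H(\phi,\psi)\ge d$ for all distinct $\phi,\psi\in\Gamma$. *)

(* Defs.v *)
From mathcomp Require Import all_boot all_fingroup.

Set Implicit Arguments.
Unset Strict Implicit.
Unset Printing Implicit Defensive.

(* [(phi * psi^-1) x] is [psi^-1 (phi x)] here, permutations being composed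
   left to right; composing right to left gives a conjugate permutation, hence
   the same number of non-fixed points. *)
Definition hamming_dist (n : nat) (phi psi : 'S_n) : nat :=
  #|[set x : 'I_n | (phi * psi^-1)%g x != x]|.

Lemma hamming_distE (n : nat) (phi psi : 'S_n) :
  hamming_dist phi psi = #|[set x : 'I_n | phi x != psi x]|.
Proof.
apply: eq_card => x; rewrite !inE permM; congr (~~ _).
by rewrite -(inj_eq (@perm_inj _ psi)) permKV.
Qed.

Definition permutation_code (n d : nat) (Gamma : {set 'S_n}) : bool :=
  [forall phi in Gamma, forall psi in Gamma,
     (phi != psi) ==> (d <= hamming_dist phi psi)].

Lemma permutation_codeP (n d : nat) (Gamma : {set 'S_n}) :
  reflect (forall phi psi : 'S_n, phi \in Gamma -> psi \in Gamma ->
             phi <> psi -> d <= hamming_dist phi psi)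
          (permutation_code d Gamma).
Proof.
apply: (iffP forall_inP) => [H phi psi Gphi Gpsi /eqP neq | H phi Gphi].
  by have /forall_inP/(_ psi Gpsi)/implyP := H phi Gphi; apply.
by apply/forall_inP => psi Gpsi; apply/implyP => /eqP; apply: H.
Qed.

Definition M (n d : nat) : nat :=
  \max_(Gamma : {set 'S_n} | permutation_code d Gamma) #|Gamma|.

Lemma M_leP (n d m : nat) :
  reflect (forall Gamma : {set 'S_n},
             (forall phi psi : 'S_n, phi \in Gamma -> psi \in Gamma ->
                phi <> psi -> d <= hamming_dist phi psi) ->
             #|Gamma| <= m)
          (M n d <= m).
Proof.
apply: (iffP idP) => [/bigmax_leqP H | H].
  by move=> Gamma /permutation_codeP; apply: H.
by apply/bigmax_leqP => Gamma /permutation_codeP; apply: H.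
Qed.

(* Main.v *)
(** A three-point semidefinite bound.  To a permutation [g] and an ordered
    triple [t] of distinct points attach an integer vector [v(g, t)] depending
    only on the conjugacy type of the pointed permutation [(g, t)], and let
    [Q(g, h)] be the sum over [t] of the inner products of [v(g, t)] and
    [v(h, t)].  For a code [Gamma] of size [n], summing [Q(k^-1 g, k^-1 h)] over
    all [k, g, h] in [Gamma] gives a sum of squares.  The vectors come from
    rounding a numerical solution of a semidefinite program, and for a positive
    constant [sigma] they satisfy [Q(1, 1) < 535 sigma], whereas the three
    rotations of a triple [(k, g, h)] at mutual distances 0 or at least 4
    contribute together at most [- sigma] if exactly two of its entries coincide
    and at most 0 if none do.  Therefore
    [0 <= n Q(1, 1) - n (n - 1) sigma], and so [n < 536].

    The inequalities for distinct entries only have to be checked for one pair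
    [(k^-1 g, k^-1 h)] per conjugacy orbit, and by rotation only when [(k, g)]
    is a closest pair of the triple. *)

Require Import Defs.
From mathcomp Require Import all_boot all_fingroup.
From mathcomp Require Import order ssralg ssrnum ssrZ zify.
From Stdlib Require Import ZArith FSets.FMapPositive.

Set Implicit Arguments.
Unset Strict Implicit.
Unset Printing Implicit Defensive.

Local Open Scope positive_scope.
Local Open Scope nat_scope.

Module PM := PositiveMap.

(** * Permutations as lists *)

Definition ap (s : seq nat) (x : nat) : nat := nth 0 s x.
Definition mulp (s t : seq nat) : seq nat := [seq ap t x | x <- s].
Definition invp (s : seq nat) : seq nat := [seq index x s | x <- iota 0 7].
Definition conjp (s t : seq nat) : seq nat := mulp (invp t) (mulp s t).
Definition idp : seq nat := iota 0 7.
Definition agree (s t : seq nat) : nat :=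
  count (fun x => ap s x == ap t x) (iota 0 7).
Definition all_perms : seq (seq nat) := permutations (iota 0 7).

(** Appends [d] as three low-order bits, so that a list of digits below 8 becomes a single key for
    [PositiveMap]. *)
Definition push (d : nat) (p : positive) : positive :=
  match d with
  | 0 => p~0~0~0 | 1 => p~0~0~1 | 2 => p~0~1~0 | 3 => p~0~1~1
  | 4 => p~1~0~0 | 5 => p~1~0~1 | 6 => p~1~1~0 | _ => p~1~1~1
  end.

Definition digits (p : positive) (s : seq nat) : positive := foldr push p s.

Definition enc (g : 'S_7) : seq nat := [seq val (g x) | x <- enum 'I_7].

Lemma ap_enc g (x : 'I_7) : ap (enc g) x = g x.
Proof. by rewrite /ap (nth_map x) ?size_enum_ord // nth_ord_enum. Qed.

Lemma enc_inj : injective enc.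
Proof. by move=> g h eq_gh; apply/permP => x; apply: ord_inj; rewrite -!ap_enc eq_gh. Qed.

Lemma enc1 : enc 1 = idp.
Proof. by rewrite /idp -val_enum_ord; apply: eq_map => x; rewrite perm1. Qed.

Lemma encM g h : enc (g * h) = mulp (enc g) (enc h).
Proof. by rewrite /mulp -map_comp; apply: eq_map => x /=; rewrite permM ap_enc. Qed.

Lemma encV g : enc g^-1 = invp (enc g).
Proof.
rewrite /invp -val_enum_ord -map_comp; apply: eq_map => x /=.
have inj_g : injective (fun y => val (g y)) by move=> y z /val_inj/perm_inj.
by rewrite -{2}(permKV g x) (index_map inj_g) index_enum_ord.
Qed.

Lemma encJ g h : enc (g ^ h) = conjp (enc g) (enc h).
Proof. by rewrite /conjg !encM encV. Qed.

Lemma perm_eq_enc g : perm_eq (enc g) (iota 0 7).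
Proof.
rewrite -val_enum_ord /enc (map_comp val g) perm_map //.
apply: uniq_perm => [||x]; rewrite ?(map_inj_uniq perm_inj) ?enum_uniq //.
by rewrite mem_enum -(permKV g x) map_f ?mem_enum.
Qed.

Lemma enc_all_perms g : enc g \in all_perms.
Proof. by rewrite mem_permutations perm_eq_enc. Qed.

(** The list is a table of values: they stay below 7 and do not repeat, which gives an injective
    self-map of ['I_7]. *)
Lemma all_permsP s : s \in all_perms -> exists g, s = enc g.
Proof.
rewrite mem_permutations => s_iota.
have size_s : size s = 7 by rewrite (perm_size s_iota).
have lt7 x : x < 7 -> ap s x < 7.
  move=> lt_x; suff: ap s x \in iota 0 7 by rewrite mem_iota.
  by rewrite -(perm_mem s_iota) mem_nth ?size_s.
pose f (x : 'I_7) := Ordinal (lt7 x (ltn_ord x)).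
have inj_f : injective f.
  move=> x y /(congr1 val) /= /eqP; rewrite /ap nth_uniq ?size_s //.
    by move/eqP/val_inj.
  by rewrite (perm_uniq s_iota) iota_uniq.
exists (perm inj_f); apply: (@eq_from_nth _ 0); rewrite size_s.
  by rewrite size_map size_enum_ord.
move=> i lt_i.
by rewrite -[RHS]/(ap _ (Ordinal lt_i)) ap_enc permE.
Qed.

(** * Agreement counts, complementary to Hamming distances *)

Definition agr (g h : 'S_7) : nat := #|[pred x | g x == h x]|.

Lemma agree_enc g h : agree (enc g) (enc h) = agr g h.
Proof.
rewrite /agree -val_enum_ord count_map enumT /agr cardE /enum_mem size_filter.
by apply: eq_count => x; rewrite /= !ap_enc.
Qed.

Lemma hamming_agr g h : hamming_dist g h = 7 - agr g h.
Proof.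
have := cardC [pred x | g x == h x]; rewrite card_ord -/(agr g h) => eq7.
have -> : hamming_dist g h = #|[predC [pred x | g x == h x]]|.
  by rewrite hamming_distE; apply: eq_card => x; rewrite !inE.
have sub7 a b : a + b = 7 -> b = 7 - a by lia.
exact: sub7.
Qed.

(** Composition is left to right, so [k] acts first and only relabels the points at which [g] and
    [h] are compared. *)
Lemma agrM g h k : agr (k * g) (k * h) = agr g h.
Proof.
rewrite /agr (eq_card (B := [preim k of [pred x | g x == h x]])) => [|x].
  rewrite card_preim; last exact: perm_inj.
  by apply: eq_card => x; rewrite !inE -{1}(permKV k x) codom_f.
by rewrite !inE !permM.
Qed.

Lemma agrJ g h k : agr (g ^ k) (h ^ k) = agr g h.
Proof.
rewrite !conjgE agrM /agr; apply: eq_card => x.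
by rewrite !inE !permM (eqtype.inj_eq (@perm_inj _ k)).
Qed.

Lemma agr_conj1 g k : agr 1 (g ^ k) = agr 1 g.
Proof. by rewrite -[in LHS](conj1g k) agrJ. Qed.

Lemma push_inj d e p q : d < 8 -> e < 8 -> push d p = push e q -> d = e /\ p = q.
Proof. by do 8?[case: d => [|d]]; do 8?[case: e => [|e]] => //= _ _ []. Qed.

(** The lowest three bits give back the head of the list; equal sizes keep digits from being
    confused with bits of the seed [p]. *)
Lemma digits_inj p s t : size s = size t -> all (ltn^~ 8) s -> all (ltn^~ 8) t ->
  digits p s = digits p t -> s = t.
Proof.
elim: s t => [|d s IHs] [|e t] //= [eq_st] /andP[d8 s8] /andP[e8 t8].
by case/(push_inj d8 e8) => -> /IHs ->.
Qed.

Lemma digits_enc_inj g h : digits 1 (enc g) = digits 1 (enc h) -> g = h.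
Proof.
have lt8 k : all (ltn^~ 8) (enc k).
  by apply/allP => _ /mapP[x _ ->]; apply: ltn_trans (ltn_ord (k x)) _.
by move/digits_inj => /(_ _ (lt8 g) (lt8 h)) eq_gh; apply/enc_inj/eq_gh; rewrite !size_map.
Qed.

(** * Orbits under conjugation *)

(** A sieve: [M] collects the keys of the conjugates, by elements of [G], of the representatives
    kept so far. *)
Fixpoint conj_reps (G X : seq (seq nat)) (M : PM.t unit) : seq (seq nat) :=
  if X is s :: X' then
    if PM.mem (digits 1 s) M then conj_reps G X' M
    else s :: conj_reps G X'
           (foldl (fun M t => PM.add (digits 1 (conjp s t)) tt M) M G)
  else [::].

Lemma mem_foldl_add (T : eqType) (f : T -> positive) (G : seq T) M k :
  PM.mem k (foldl (fun M t => PM.add (f t) tt M) M G) ->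
  PM.mem k M \/ exists2 t, t \in G & k = f t.
Proof.
elim: G M => [|t G IHG] M /=; first by left.
case/IHG => [|[u Gu ->]]; last by right; exists u; rewrite // inE Gu orbT.
have [<-|k_neq] := Pos.eq_dec (f t) k.
  by right; exists t; rewrite ?inE ?eqxx.
by rewrite !PM.mem_find PM.gso; [left | move=> eq_k; apply: k_neq].
Qed.

Lemma conj_repsP G X M s : s \in X -> PM.mem (digits 1 s) M \/
  exists r, [/\ r \in conj_reps G X M, r \in X &
    s = r \/ exists2 t, t \in G & digits 1 s = digits 1 (conjp r t)].
Proof.
elim: X M => [|x X IHX] M //=; rewrite inE => s_in.
case: ifP => [x_M|_].
  case/orP: s_in => [/eqP->|/(IHX M)]; first by left.
  case=> [|[r [r_in rX sr]]]; [by left | right; exists r; split=> //].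
  by rewrite inE rX orbT.
case/orP: s_in => [/eqP->|/IHX].
  by right; exists x; rewrite !inE eqxx; split=> //; left.
(* A key in [M'] is either an old one or that of a conjugate of [x], and then [x] is the
   representative. *)
set M' := foldl _ _ _ => /(_ M')[/mem_foldl_add[|[t Gt ->]]|[r [r_in rX sr]]].
- by left.
- by right; exists x; rewrite !inE eqxx; split=> //; right; exists t.
- by right; exists r; rewrite !inE r_in rX !orbT.
Qed.

Lemma conj_reps_enc (G : seq (seq nat)) X g :
    {subset G <= all_perms} -> {subset X <= all_perms} -> enc g \in X ->
  exists r h, [/\ enc r \in conj_reps G X (PM.empty _), enc r \in X,
    h = 1%g \/ enc h \in G & g = (r ^ h)%g].
Proof.
move=> G_perms X_perms /(@conj_repsP G X (PM.empty _)).
rewrite PM.mem_find PM.gempty => -[//|[s [s_in sX]]].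
have [r def_s] := all_permsP (X_perms s sX); rewrite {s}def_s in s_in sX *.
case=> [/enc_inj->|[t Gt]].
  by exists r, 1%g; rewrite conjg1; split=> //; left.
have [h def_t] := all_permsP (G_perms t Gt); rewrite {t}def_t in Gt *.
by rewrite -encJ => /digits_enc_inj ->; exists r, h; split=> //; right.
Qed.

(** * Sums of inner products over pointed permutations *)

(** Stops at the end of the shorter list, so that [[::]] acts as the zero vector. *)
Fixpoint dot (v w : seq Z) : Z :=
  match v, w with
  | x :: v', y :: w' => (x * y + dot v' w')%Z
  | _, _ => 0%Z
  end.

Lemma dot_nilr v : dot v [::] = 0%Z.
Proof. by case: v. Qed.

Lemma dotE n v w : size v <= n ->
  dot v w = (\sum_(r < n) nth 0 v r * nth 0 w r)%R.
Proof.
elim: n v w => [|n IHn] [|x v] // => [w _|w _|w size_v]; rewrite ?big_ord0 //.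
  by rewrite big1 //= => r _; rewrite nth_nil GRing.mul0r.
case: w => [|y w]; last by rewrite big_ord_recl /= (IHn v).
by rewrite big1 //= => r _; rewrite nth_nil GRing.mulr0.
Qed.

(** Exchanging sums turns this into a sum over coordinates [r] of the square of the total [r]-th
    coordinate. *)
Lemma sum_dot_ge0 (T : finType) (A : {pred T}) (f : T -> seq Z) :
  (0 <= \sum_(i in A) \sum_(j in A) dot (f i) (f j))%R.
Proof.
(* Vectors shorter than [n] are padded by the default 0 of [nth]. *)
pose n := \max_i size (f i).
rewrite (_ : (\sum_(i in A) _)%R = (\sum_(r < n) (\sum_(i in A) nth 0 (f i) r) ^+ 2)%R).
  by apply: Num.Theory.sumr_ge0 => r _; apply: Num.Theory.sqr_ge0.
under eq_bigr => i _ do under eq_bigr => j _ do rewrite (@dotE n) ?leq_bigmax //.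
under eq_bigr => i _ do rewrite exchange_big.
rewrite exchange_big /=; apply: eq_bigr => r _.
by rewrite GRing.expr2 GRing.mulr_suml; under [RHS]eq_bigr => i _ do rewrite GRing.mulr_sumr.
Qed.

(** * Tabulated inner products *)

Fixpoint map_values (A B : Type) (f : A -> B) (M : PM.t A) : PM.t B :=
  match M with
  | PM.Leaf => PM.Leaf B
  | PM.Node l o r => PM.Node (map_values f l) (option_map f o) (map_values f r)
  end.

Lemma find_map_values A B (f : A -> B) k M :
  PM.find k (map_values f M) = option_map f (PM.find k M).
Proof. by elim: k M => [k IHk|k IHk|] [|l o r] //=; apply: IHk. Qed.

Section Gram.

Variable vector_map : PM.t (seq Z).

Definition vec (k : positive) : seq Z :=
  if PM.find k vector_map is Some v then v else [::].

(** Each inner product is computed once; afterwards the check needs only lookups and additions. *)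
Definition gram_map : PM.t (PM.t Z) :=
  map_values (fun v => map_values (dot v) vector_map) vector_map.

Definition gram_row (G : PM.t (PM.t Z)) (k : positive) : PM.t Z :=
  if PM.find k G is Some row then row else PM.empty _.

Fixpoint rowsum (v : seq (PM.t Z)) (w : seq positive) : Z :=
  match v, w with
  | row :: v', y :: w' =>
      (if PM.find y row is Some z then z + rowsum v' w' else rowsum v' w')%Z
  | _, _ => 0%Z
  end.

(** A key missing on either side contributes 0, in agreement with the empty vector that [vec]
    returns for it. *)
Lemma rowsumE (T : Type) (s : seq T) (f g : T -> positive) :
  rowsum [seq gram_row gram_map (f t) | t <- s] (map g s) =
  (\sum_(t <- s) dot (vec (f t)) (vec (g t)))%R.
Proof.
elim: s => [|t s IHs]; rewrite ?big_nil ?big_cons //= -IHs /gram_row /gram_map /vec.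
rewrite find_map_values; case: (PM.find (f t) _) => [v|] /=; last by rewrite PM.gempty.
by rewrite find_map_values; case: (PM.find (g t) _) => [w|] //=; rewrite dot_nilr.
Qed.

End Gram.

(* The step number of [(x, y)] is the least [m] with [s^(m+1) x = y], and 7 if [x]
   and [y] lie in different cycles. *)
Definition step_table (s : seq nat) : seq (seq nat) :=
  [seq let o := traject (ap s) (ap s x) 7 in [seq index y o | y <- iota 0 7]
     | x <- iota 0 7].

Definition step (D : seq (seq nat)) (x y : nat) : nat := nth 0 (nth [::] D x) y.

(** For the step table of a permutation, [step D x x] is one less than the length of the cycle of
    [x]; the result is the sum of [c (c - 1)] over the cycle lengths [c]. *)
Definition rank (D : seq (seq nat)) : nat :=
  sumn [seq step D x x | x <- iota 0 7].

Definition triples : seq (nat * seq (nat * seq nat)) :=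
  [seq (i, [seq (j, [seq l <- iota 0 7 | (l != i) && (l != j)])
              | j <- [seq j <- iota 0 7 | j != i]])
     | i <- iota 0 7].

(* [s |-> pointed_type (s, t)] for all [t] at once, sharing common prefixes; see
   [types_enc]. *)
Definition types (s : seq nat) : seq positive :=
  let D := step_table s in
  let p := Pos.of_succ_nat (rank D) in
  let diag := [seq step D x x | x <- iota 0 7] in
  flatten [seq let i := il.1 in
    let Di := nth [::] D i in
    let pi := push (nth 0 diag i) p in
    flatten [seq let j := jl.1 in
      let Dj := nth [::] D j in
      let pij := push (nth 0 Di j) (push (nth 0 diag j) pi) in
      [seq push (nth 0 diag l) (push (nth 0 Di l) (push (nth 0 Dj l) pij)) | l <- jl.2]
    | jl <- il.2] | il <- triples].

(** * Conjugation-invariant types of pointed permutations *)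

Definition steps (g : 'S_7) (x y : 'I_7) : nat := index y (traject g (g x) 7).

Lemma step_enc g (x y : 'I_7) : step (step_table (enc g)) x y = steps g x y.
Proof.
have traj n (z : 'I_7) : traject (ap (enc g)) z n = map val (traject g z n).
  by elim: n z => //= n IHn z; rewrite ap_enc IHn.
rewrite /step /step_table (nth_map 0) ?size_iota // nth_iota // add0n.
rewrite (nth_map 0) ?size_iota // nth_iota // add0n ap_enc traj.
by rewrite (index_map val_inj).
Qed.

Lemma stepsJ g h x y : steps (g ^ h) (h x) (h y) = steps g x y.
Proof.
have traj n z : traject (g ^ h)%g (h z) n = map h (traject g z n).
  by elim: n z => //= n IHn z; rewrite permJ IHn.
by rewrite /steps permJ traj (index_map perm_inj).
Qed.

Definition rk (g : 'S_7) : nat := \sum_x steps g x x.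

Lemma rank_enc g : rank (step_table (enc g)) = rk g.
Proof.
rewrite /rank -val_enum_ord -map_comp sumnE big_map /rk big_enum /=.
by apply: eq_bigr => x _; rewrite step_enc.
Qed.

Lemma rkJ g h : rk (g ^ h) = rk g.
Proof.
rewrite /rk (reindex_inj (@perm_inj _ h)) /=.
by apply: eq_bigr => x _; rewrite stepsJ.
Qed.

(** One direction per pair suffices: for distinct [x], [y] in a cycle of length [c],
    [steps g y x = c - 2 - steps g x y]. Pointed permutations that share a key simply receive the
    same vector. *)
Definition pointed_type (g : 'S_7) (t : 'I_7 * 'I_7 * 'I_7) : positive :=
  let: (i, j, l) := t in
  digits (Pos.of_succ_nat (rk g))
    [:: steps g l l; steps g i l; steps g j l; steps g i j; steps g j j; steps g i i].

Definition ord_triples : seq ('I_7 * 'I_7 * 'I_7) :=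
  flatten [seq flatten [seq [seq (i, j, l) | l <- enum 'I_7 & (l != i) && (l != j)]
    | j <- enum 'I_7 & j != i] | i <- enum 'I_7].

Lemma types_enc g : types (enc g) = map (pointed_type g) ord_triples.
Proof.
pose diag := [seq step (step_table (enc g)) x x | x <- iota 0 7].
rewrite /types -/diag.
have diagE (x : 'I_7) : nth 0 diag x = steps g x x.
  by rewrite (nth_map 0) ?size_iota // nth_iota // step_enc.
rewrite /triples -val_enum_ord /ord_triples.
(* With an arbitrary list [e] in place of the enumeration, nothing is expanded and the nested maps
   are compared termwise. *)
move: diag diagE (enum 'I_7) => diag diagE e.
rewrite map_flatten -!map_comp; congr flatten; apply: eq_map => i /=.
rewrite map_flatten filter_map -!map_comp; congr flatten.
apply: eq_map => j /=; rewrite filter_map -!map_comp; apply: eq_map => l /=.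
by rewrite !diagE -!/(step _ _ _) !step_enc rank_enc.
Qed.

Lemma sum_ord_triples (F : 'I_7 * 'I_7 * 'I_7 -> Z) :
  (\sum_(t <- ord_triples) F t =
   \sum_i \sum_(j | j != i) \sum_(l | (l != i) && (l != j)) F (i, j, l))%R.
Proof.
rewrite /ord_triples big_flatten big_map big_enum /=; apply: eq_bigr => i _.
rewrite big_flatten big_map big_filter big_enum_cond /=; apply: eq_bigr => j _.
by rewrite big_map big_filter big_enum_cond.
Qed.

(** * Sums over ordered triples of elements of a set *)

Section TripleSums.

Variables (I : finType) (A : {pred I}).

Lemma sum_rotations (T : I -> I -> I -> Z) :
  (\sum_(k in A) \sum_(g in A) \sum_(h in A) (T k g h + T g h k + T h k g) =
   (\sum_(k in A) \sum_(g in A) \sum_(h in A) T k g h) *+ 3)%R.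
Proof.
under eq_bigr => k _ do under eq_bigr => g _ do rewrite !big_split /=.
under eq_bigr => k _ do rewrite !big_split /=.
rewrite !big_split /= !GRing.mulrS GRing.mulr0n GRing.addr0 -GRing.addrA.
congr (_ + (_ + _))%R.
  by rewrite exchange_big /=; apply: eq_bigr => g _; apply: exchange_big.
by under eq_bigr => k _ do rewrite exchange_big /=; apply: exchange_big.
Qed.

Lemma sum_if_eq (F : I -> Z) k : k \in A ->
  (\sum_(g in A) (if k == g then F g else 0) = F k)%R.
Proof.
move=> Ak; rewrite (bigD1 k) //= eqxx big1 ?GRing.addr0 // => g /andP[_ /negPf].
by rewrite eq_sym => ->.
Qed.

(** Each of the three equalities leaves two free variables, and full coincidence leaves one. *)
Lemma sum_coincidences (a b : Z) :
  (\sum_(k in A) \sum_(g in A) \sum_(h in A)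
     ((if k == g then a else 0) + (if g == h then a else 0) + (if h == k then a else 0)
      + (if (k == g) && (g == h) then b else 0)) =
   a *+ #|A| *+ #|A| *+ 3 + b *+ #|A|)%R.
Proof.
under eq_bigr => k _ do under eq_bigr => g _ do rewrite !big_split /=.
under eq_bigr => k _ do rewrite !big_split /=.
rewrite !big_split /= !(GRing.mulrS _ 2, GRing.mulrS _ 1) GRing.mulr1n GRing.addrA.
rewrite -!GRing.sumr_const; congr (_ + _ + _ + _)%R; apply: eq_bigr => k Ak.
- by rewrite exchange_big; apply: eq_bigr => h _; rewrite sum_if_eq.
- by apply: eq_bigr => g Ag; rewrite sum_if_eq.
- by apply: eq_bigr => g _; under eq_bigr => h _ do rewrite eq_sym; rewrite sum_if_eq.
rewrite -[RHS](@sum_if_eq (fun=> b) k) //; apply: eq_bigr => g Ag.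
by case: (k == g) => /=; [rewrite sum_if_eq | rewrite big1].
Qed.

End TripleSums.

Lemma mulrn_Z (x : Z) n : (x *+ n)%R = (x * Z.of_nat n)%Z.
Proof.
elim: n => [|n IHn]; first by rewrite GRing.mulr0n Z.mul_0_r.
by rewrite GRing.mulrS IHn Nat2Z.inj_succ Z.mul_succ_r Z.add_comm.
Qed.

(** * The finite verification *)

Definition rows (G : PM.t (PM.t Z)) (s : seq nat) := map (gram_row G) (types s).

(** The terms belong to the rotations of [(1, a, b)], each translated to start at the identity. What
    depends on [a] alone is bound before [fun b], so that a partial application computes it once. *)
Definition Q3p (G : PM.t (PM.t Z)) (a : seq nat) : seq nat -> Z :=
  let ra := rows G a in let a' := invp a in let ta' := types a' in
  fun b => let b' := invp b in
  (rowsum ra (types b) + rowsum (rows G (mulp a' b)) ta'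
   + rowsum (rows G b') (types (mulp b' a)))%Z.

(** At most 3 fixed points among 7 means distance at least 4 from the identity. *)
Definition a_reps := conj_reps all_perms
  [seq s <- all_perms | agree idp s <= 3] (PM.empty _).

(** Once [a] is fixed, conjugation by its centralizer remains available. The filter makes [(1, a)] a
    closest pair of [(1, a, b)]; for [a] in [a_reps] it also excludes [b = 1] and [b = a]. *)
Definition b_reps (a : seq nat) :=
  conj_reps [seq t <- all_perms | mulp a t == mulp t a]
    [seq b <- all_perms | (agree idp b <= agree idp a) && (agree a b <= agree idp a)]
    (PM.empty _).

(** The first test concerns the triple [(1, 1, a)], the second the triples [(1, a, b)] with distinct
    entries. *)
Definition check_pair (G : PM.t (PM.t Z)) (sigma : Z) (a : seq nat) : bool :=
  let f := Q3p G a in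
  (Q3p G idp a <=? - sigma)%Z && all (fun b => f b <=? 0)%Z (b_reps a).

Definition check (vector_map : PM.t (seq Z)) (sigma : Z) : bool :=
  let G := gram_map vector_map in
  [&& (0 <? sigma)%Z, (rowsum (rows G idp) (types idp) <? 535 * sigma)%Z
    & all (check_pair G sigma) a_reps].

(** * From the verification to inequalities for all permutations *)

Section Certificate.

Variable vector_map : PM.t (seq Z).

Definition Q (g h : 'S_7) : Z := rowsum (rows (gram_map vector_map) (enc g)) (types (enc h)).

Definition Q3 (g h : 'S_7) : Z := (Q g h + Q (g^-1 * h)%g g^-1%g + Q h^-1%g (h^-1 * g)%g)%Z.

(* Conversion would otherwise try to compute with these functions. *)
Local Opaque rowsum types conj_reps all_perms agree.

Lemma Q3pE g h : Q3p (gram_map vector_map) (enc g) (enc h) = Q3 g h.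
Proof. by rewrite /Q3 /Q !encM !encV. Qed.

Lemma QE g h : Q g h = (\sum_(t <- ord_triples)
  dot (vec vector_map (pointed_type g t)) (vec vector_map (pointed_type h t)))%R.
Proof. by rewrite /Q /rows !types_enc -map_comp rowsumE. Qed.

(** Relabelling the points by [s] permutes the triples summed over and matches the types of [g] with
    those of [g ^ s]. *)
Lemma QJ g h s : Q (g ^ s)%g (h ^ s)%g = Q g h.
Proof.
rewrite !QE !sum_ord_triples (reindex_inj (@perm_inj _ s)); apply: eq_bigr => i _ /=.
rewrite (reindex_inj (@perm_inj _ s)) /=.
apply: eq_big => [j|j _]; first by rewrite (eqtype.inj_eq (@perm_inj _ s)).
rewrite (reindex_inj (@perm_inj _ s)) /=.
apply: eq_big => [l|l _]; first by rewrite !(eqtype.inj_eq (@perm_inj _ s)).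
by rewrite !rkJ !stepsJ.
Qed.

Lemma Q3J g h s : Q3 (g ^ s)%g (h ^ s)%g = Q3 g h.
Proof. by rewrite /Q3 -!conjVg -!conjMg !QJ. Qed.

(** For fixed [k] and a fixed triple [t] of points, the sum over [g] and [h] is the one in
    [sum_dot_ge0]. *)
Lemma sum_Q_ge0 (Gamma : {set 'S_7}) :
  (0 <= \sum_(k in Gamma) \sum_(g in Gamma) \sum_(h in Gamma) Q (k^-1 * g)%g (k^-1 * h)%g)%R.
Proof.
apply: Num.Theory.sumr_ge0 => k _.
under eq_bigr => g _ do under eq_bigr => h _ do rewrite QE.
under eq_bigr => g _ do rewrite exchange_big.
rewrite exchange_big /=; apply: Num.Theory.sumr_ge0 => t _.
exact: (sum_dot_ge0 _ (fun g => vec vector_map (pointed_type (k^-1 * g)%g t))).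
Qed.

Variable sigma : Z.
Hypothesis sigma_check : check vector_map sigma.

Lemma sigma_gt0 : (0 < sigma)%Z.
Proof. by case/and3P: sigma_check => /Z.ltb_lt. Qed.

Lemma Q11_lt : (Q 1 1 < 535 * sigma)%Z.
Proof. by case/and3P: sigma_check => _; rewrite -enc1 => /Z.ltb_lt. Qed.

Lemma a_reps_conj g : agr 1 g <= 3 ->
  exists r s, [/\ g = (r ^ s)%g, agr 1 r = agr 1 g
    & check_pair (gram_map vector_map) sigma (enc r)].
Proof.
move=> g_le3; case: (@conj_reps_enc all_perms [seq s <- all_perms | agree idp s <= 3] g).
- by [].
- by move=> s; rewrite mem_filter => /andP[].
- by rewrite mem_filter -enc1 agree_enc g_le3 enc_all_perms.
move=> r [s [r_in _ _ def_g]]; exists r, s; split=> //.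
  by rewrite def_g agr_conj1.
by case/and3P: sigma_check => _ _ /allP; apply.
Qed.

Lemma Q3_1_le g : agr 1 g <= 3 -> (Q3 1 g <= - sigma)%R.
Proof.
case/a_reps_conj => r [s [-> _ /andP[+ _]]].
by rewrite -[X in Q3 X _](conj1g s) Q3J -enc1 Q3pE => /Z.leb_le le_r; apply/Z.leb_le.
Qed.

(** One conjugation takes [g] to its representative [r]; a second one, by an element commuting with
    [r], takes the conjugated [h] to a checked [b]. Agreement counts and [Q3] do not change. *)
Lemma Q3_le0 g h : agr 1 g <= 3 -> agr 1 h <= agr 1 g -> agr g h <= agr 1 g ->
  (Q3 g h <= 0)%R.
Proof.
case/a_reps_conj => r [s [def_g <- /andP[_ /allP check_r]]] le_h le_gh.
pose h' := (h ^ s^-1)%g; have def_h : h = (h' ^ s)%g by rewrite conjgKV.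
rewrite def_h agr_conj1 in le_h; rewrite def_g def_h agrJ in le_gh.
rewrite def_g def_h Q3J {def_g def_h}.
case: (@conj_reps_enc [seq t <- all_perms | mulp (enc r) t == mulp t (enc r)]
  [seq b <- all_perms | (agree idp b <= agree idp (enc r))
                        && (agree (enc r) b <= agree idp (enc r))] h').
- by move=> t; rewrite mem_filter => /andP[].
- by move=> t; rewrite mem_filter => /andP[].
- by rewrite mem_filter -enc1 !agree_enc le_h le_gh enc_all_perms.
move=> b [t [b_in _ t_cent ->]].
have {t_cent} t_r : (r ^ t)%g = r.
  case: t_cent => [->|]; first by rewrite conjg1.
  rewrite mem_filter -!encM => /andP[/eqP/enc_inj rt _].
  by rewrite conjgE rt mulKg.
(* Writing [r] as [r ^ t] makes both arguments conjugates by [t]. *)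
by rewrite -{1}t_r Q3J; move/check_r: b_in; rewrite Q3pE.
Qed.

(** * The bound for a code *)

Section Code.

Variable Gamma : {set 'S_7}.
Hypothesis Gamma_code : forall g h, g \in Gamma -> h \in Gamma -> g <> h ->
  4 <= hamming_dist g h.

Let T (k g h : 'S_7) : Z := Q (k^-1 * g)%g (k^-1 * h)%g.

(** The translation cancels in the quotients, for instance [(k^-1 g)^-1 (k^-1 h) = g^-1 h]. *)
Lemma Q3_rot k g h : Q3 (k^-1 * g)%g (k^-1 * h)%g = (T k g h + T g h k + T h k g)%R.
Proof. by rewrite /Q3 /T !invMg !invgK !mulgA !mulgK. Qed.

Lemma agr_code g h : g \in Gamma -> h \in Gamma -> g != h -> agr g h <= 3.
Proof.
by move=> Gg Gh /eqP neq; move: (Gamma_code Gg Gh neq); rewrite hamming_agr; lia.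
Qed.

Lemma agrC g h : agr g h = agr h g.
Proof. by apply: eq_card => x; rewrite !inE eq_sym. Qed.

Lemma agr_mulV k g : agr 1 (k^-1 * g) = agr k g.
Proof. by rewrite -[in LHS](mulVg k) agrM. Qed.

(** Chosen so that for [k = g = h] the bound [U] equals [- 3 sigma + 3 B = 3 Q 1 1], the exact value
    of the rotation sum. *)
Let B := (sigma + Q 1 1)%Z.

Let U (k g h : 'S_7) : Z :=
  ((if k == g then - sigma else 0) + (if g == h then - sigma else 0)
   + (if h == k then - sigma else 0)
   + (if (k == g) && (g == h) then B + B + B else 0))%Z.

(** Both sides are invariant under rotation, so a triple may be taken constant, of the form
    [(x, x, y)], or with distinct entries of which the first two agree most. *)
Lemma rot_le k g h : k \in Gamma -> g \in Gamma -> h \in Gamma ->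
  (T k g h + T g h k + T h k g <= U k g h)%R.
Proof.
have rotC x y z : (T x y z + T y z x + T z x y = T y z x + T z x y + T x y z)%R.
  by rewrite [RHS]GRing.addrC GRing.addrA.
have pair x y : x \in Gamma -> y \in Gamma -> x != y ->
    (T x x y + T x y x + T y x x <= - sigma)%R.
  move=> Gx Gy neq; rewrite -Q3_rot mulVg; apply: Q3_1_le.
  by rewrite agr_mulV agr_code.
have closest x y z : x \in Gamma -> y \in Gamma -> z \in Gamma -> x != y ->
    agr x z <= agr x y -> agr y z <= agr x y ->
    (T x y z + T y z x + T z x y <= 0)%R.
  move=> Gx Gy Gz neq le_xz le_yz; rewrite -Q3_rot; apply: Q3_le0; rewrite ?agrM ?agr_mulV //.
  exact: agr_code.
have diag x : T x x x = Q 1 1 by rewrite /T !mulVg.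
move=> Gk Gg Gh; rewrite /U /B; move: (Q 1 1) diag => q diag; clearbody T.
have [<-|k_g] /= := eqVneq k g.
  have [<-|k_h] := eqVneq k h.
    by rewrite !diag /=; lia.
  have := pair k h Gk Gh k_h; lia.
have [<-|g_h] /= := eqVneq g h.
  have := pair g k Gg Gk; rewrite eq_sym => /(_ k_g).
  rewrite (rotC g g k) (rotC g k g); lia.
have [->|h_k] /= := eqVneq h k.
  have := pair k g Gk Gg k_g; rewrite (rotC k k g); lia.
(* The entries are now distinct, and one of the three agreement counts is largest; its pair is
   rotated to the front. *)
have [le1 | le2 | le3] : [\/ (agr k h <= agr k g) && (agr g h <= agr k g),
    (agr k g <= agr g h) && (agr k h <= agr g h)
  | (agr g h <= agr k h) && (agr k g <= agr k h)].
  case: (leqP (agr k h) (agr k g)) => le_a; case: (leqP (agr g h) (agr k g)) => le_b.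
  - by constructor 1.
  - by constructor 2; rewrite (ltnW le_b) (leq_trans le_a (ltnW le_b)).
  - by constructor 3; rewrite (ltnW le_a) (leq_trans le_b (ltnW le_a)).
  - case: (leqP (agr k h) (agr g h)) => le_c; first by constructor 2; rewrite (ltnW le_b).
    by constructor 3; rewrite (ltnW le_c) (ltnW le_a).
- case/andP: le1 => *; have := closest k g h Gk Gg Gh k_g; lia.
- case/andP: le2 => *; have := closest g h k Gg Gh Gk g_h.
  rewrite (agrC g k) (agrC h k) (rotC k g h); lia.
- case/andP: le3 => *; have := closest h k g Gh Gk Gg h_k.
  rewrite (agrC h k) (agrC h g) (rotC k g h) (rotC g h k); lia.
Qed.

Lemma card_code_le : #|Gamma| <= 535.
Proof.
have : (0 <= (\sum_(k in Gamma) \sum_(g in Gamma) \sum_(h in Gamma) T k g h) *+ 3)%R.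
  by rewrite Num.Theory.mulrn_wge0 //; apply: sum_Q_ge0.
rewrite -sum_rotations => /Order.POrderTheory.le_trans.
move/(_ _ (Num.Theory.ler_sum _ (fun k Gk => Num.Theory.ler_sum _ (fun g Gg =>
   Num.Theory.ler_sum _ (fun h Gh => rot_le Gk Gg Gh))))).
(* With [n] the size of [Gamma], the upper bound becomes [- 3 sigma n^2 + 3 (sigma + Q 1 1) n]. *)
rewrite sum_coincidences !mulrn_Z /B.
move: (Q 1 1) Q11_lt sigma_gt0 => q lt_q gt0 le_sum.
rewrite leqNgt; apply/negP => gt_n.
move: {gt_n} #|Gamma| (gt_n) le_sum => n lt_n.
(* For such [n], [sigma (n - 1) >= 535 sigma > Q 1 1] makes the upper bound negative. *)
have : (536 <= Z.of_nat n)%Z by lia.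
move: (Z.of_nat n) => N leN; move/Z.leb_le; nia.
Qed.

End Code.

End Certificate.

(** * The numerical certificate *)

(* An entry [(r, [:: d1; ...; d6], v)] assigns [v] to the pointed permutations
   [(g, (i, j, l))] with [rk g = r] whose step numbers for the pairs [(l, l)],
   [(i, l)], [(j, l)], [(i, j)], [(j, j)], [(i, i)] are [d1], ..., [d6]; no entry
   is needed for the permutations that move one to three points. *)
Definition certificate : seq (nat * seq nat * seq Z) := [::
(0, [:: 0; 7; 7; 7; 0; 0], [:: 31916; 451; -113; 76; 8; 4; 0; 0]%Z);
(4, [:: 0; 7; 7; 7; 0; 0], [:: -2659; 4226; -817; 682; -1065; -4; -950; -429]%Z);
(4, [:: 1; 7; 7; 7; 0; 0], [:: -688; 461; -638; -133; 589; 101; 248; 152]%Z);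
(4, [:: 1; 7; 0; 7; 1; 0], [:: -4201; -1772; 646; -1246; 204; 195; 257; 211]%Z);
(4, [:: 0; 7; 7; 7; 1; 0], [:: 46; 2116; 154; 1320; -406; -145; -209; -254]%Z);
(4, [:: 1; 7; 7; 7; 1; 0], [:: -886; 1799; -1373; -237; 682; 185; -59; 104]%Z);
(4, [:: 1; 0; 7; 7; 0; 1], [:: 5917; -1711; 899; -330; 284; -895; -602; -74]%Z);
(4, [:: 0; 7; 7; 7; 0; 1], [:: 999; -279; 342; -5; 96; -47; 257; 104]%Z);
(4, [:: 1; 7; 7; 7; 0; 1], [:: -2674; 2517; -139; 618; -797; 336; 63; -111]%Z);
(4, [:: 0; 7; 7; 0; 1; 1], [:: 1691; 230; -433; -556; 500; -92; -27; 150]%Z);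
(4, [:: 1; 7; 7; 0; 1; 1], [:: -2998; 2183; 844; 1286; -1172; 261; 235; -199]%Z);
(4, [:: 1; 7; 0; 7; 1; 1], [:: 4934; 5052; -1692; 2179; -132; -248; -432; -319]%Z);
(4, [:: 1; 0; 7; 7; 1; 1], [:: 2407; -2583; 2187; 111; -559; -674; -133; -124]%Z);
(4, [:: 0; 7; 7; 7; 1; 1], [:: -1295; -107; -265; -722; 89; 181; 234; 182]%Z);
(6, [:: 1; 7; 0; 7; 1; 0], [:: 1365; -3691; -3624; 643; -337; 765; 330; -416]%Z);
(6, [:: 1; 7; 7; 7; 1; 0], [:: -6; -1047; -150; 39; -107; -69; 88; 104]%Z);
(6, [:: 1; 0; 7; 7; 0; 1], [:: 284; 1378; 3888; -548; 839; 248; 199; -756]%Z);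
(6, [:: 1; 7; 7; 7; 0; 1], [:: -266; 164; -637; 187; -306; -115; -89; 189]%Z);
(6, [:: 0; 7; 7; 0; 1; 1], [:: -67; 1385; 2722; -27; 206; -86; 444; -5]%Z);
(6, [:: 1; 7; 7; 0; 1; 1], [:: -875; -227; -1397; 119; -255; -79; -96; 126]%Z);
(6, [:: 1; 7; 0; 7; 1; 1], [:: -217; 848; 1112; -70; -28; -193; -70; 94]%Z);
(6, [:: 1; 0; 7; 7; 1; 1], [:: 120; -380; -203; -507; 511; 369; -415; -825]%Z);
(6, [:: 0; 7; 7; 7; 1; 1], [:: -178; 162; -345; 57; -147; -30; -151; 1]%Z);
(6, [:: 1; 7; 7; 7; 1; 1], [:: 180; 507; 695; 353; -321; -126; 244; 303]%Z);
(8, [:: 1; 7; 7; 7; 0; 0], [:: -63; -664; 109; 37; -72; 304; -355; -251]%Z);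
(8, [:: 2; 7; 7; 7; 0; 0], [:: 719; -199; -881; 446; 158; -153; 167; 193]%Z);
(8, [:: 1; 7; 0; 7; 1; 0], [:: -1867; -439; -713; 622; 689; 104; -786; -291]%Z);
(8, [:: 0; 7; 7; 7; 1; 0], [:: 207; 468; 337; -532; -353; -273; -56; -81]%Z);
(8, [:: 2; 7; 7; 7; 1; 0], [:: 393; 391; -381; 228; -89; -27; 279; 184]%Z);
(8, [:: 2; 7; 0; 7; 2; 0], [:: -340; -54; -139; 67; -313; -731; -141; -150]%Z);
(8, [:: 2; 7; 1; 7; 2; 0], [:: -489; -791; -825; 626; 792; 922; -56; 771]%Z);
(8, [:: 0; 7; 7; 7; 2; 0], [:: -166; 786; -798; -283; -113; -600; 97; -159]%Z);
(8, [:: 1; 7; 7; 7; 2; 0], [:: 184; 277; -505; 43; -68; 123; -95; -304]%Z);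
(8, [:: 1; 0; 7; 7; 0; 1], [:: 1161; 78; 179; -679; -260; 311; 675; 316]%Z);
(8, [:: 0; 7; 7; 7; 0; 1], [:: -214; -649; 509; 131; -49; -49; -251; -823]%Z);
(8, [:: 2; 7; 7; 7; 0; 1], [:: 76; 487; 166; 122; 482; -106; -173; 229]%Z);
(8, [:: 0; 7; 7; 0; 1; 1], [:: 379; 109; 32; -446; 660; 205; -210; -283]%Z);
(8, [:: 2; 7; 7; 0; 1; 1], [:: -398; -316; -146; 222; 117; -181; -81; 116]%Z);
(8, [:: 2; 7; 0; 7; 2; 1], [:: 593; 732; 59; -38; 1540; -1908; 593; -75]%Z);
(8, [:: 2; 7; 1; 7; 2; 1], [:: 739; -83; -45; -156; -52; 1237; -723; -106]%Z);
(8, [:: 1; 0; 7; 7; 2; 1], [:: 823; -905; -177; -35; -976; 299; 584; 366]%Z);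
(8, [:: 0; 7; 7; 7; 2; 1], [:: 39; -14; 15; 50; 290; 273; -353; -117]%Z);
(8, [:: 2; 0; 7; 7; 0; 2], [:: -390; -213; 103; -438; -843; 618; -555; -1008]%Z);
(8, [:: 2; 1; 7; 7; 0; 2], [:: -334; -323; 412; -448; -98; -173; 710; 370]%Z);
(8, [:: 0; 7; 7; 7; 0; 2], [:: -169; 714; -132; -355; -21; 84; 201; 545]%Z);
(8, [:: 1; 7; 7; 7; 0; 2], [:: -608; 264; -217; 70; -31; -160; -70; -27]%Z);
(8, [:: 1; 7; 0; 7; 1; 2], [:: 954; 543; 241; -455; -713; -40; 586; 200]%Z);
(8, [:: 2; 0; 7; 7; 1; 2], [:: -374; -13; 284; -517; -354; -349; 227; -160]%Z);
(8, [:: 2; 1; 7; 7; 1; 2], [:: -613; -45; -153; -164; 327; 602; -715; -321]%Z);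
(8, [:: 0; 7; 7; 7; 1; 2], [:: -438; -124; -244; 183; -245; 68; 126; 116]%Z);
(8, [:: 2; 1; 0; 0; 2; 2], [:: 139; 585; 23; -738; -2925; 179; -144; -1730]%Z);
(8, [:: 0; 7; 7; 0; 2; 2], [:: 143; -344; 505; 1; 227; -216; 883; 910]%Z);
(8, [:: 1; 7; 7; 0; 2; 2], [:: -1019; 333; -28; 165; 890; 277; -664; 98]%Z);
(8, [:: 2; 0; 1; 1; 2; 2], [:: -237; 209; -281; -11; -21; 767; 451; 815]%Z);
(8, [:: 0; 7; 7; 1; 2; 2], [:: 93; -175; 230; -12; -512; 353; -299; -505]%Z);
(8, [:: 1; 7; 7; 1; 2; 2], [:: -773; 426; 438; -220; 135; -803; 260; 149]%Z);
(10, [:: 1; 7; 7; 0; 1; 1], [:: -814; -39; 77; -359; -640; -262; 304; 51]%Z);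
(10, [:: 2; 7; 7; 0; 1; 1], [:: 315; 808; 384; 383; 433; 325; -198; 122]%Z);
(10, [:: 1; 7; 0; 7; 1; 1], [:: -1076; 95; 1355; 1763; 1021; 81; 378; 210]%Z);
(10, [:: 1; 0; 7; 7; 1; 1], [:: -1573; -518; -1180; -747; -322; -239; -175; -821]%Z);
(10, [:: 2; 7; 7; 7; 1; 1], [:: 640; -84; -493; -193; -147; 209; -166; 170]%Z);
(10, [:: 2; 7; 0; 7; 2; 1], [:: -365; 195; -503; 448; -1373; 523; 949; 306]%Z);
(10, [:: 2; 7; 1; 7; 2; 1], [:: -498; 175; -372; -214; 1482; 21; -965; -75]%Z);
(10, [:: 1; 0; 7; 7; 2; 1], [:: -715; 32; -6; 219; 682; 20; -372; -707]%Z);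
(10, [:: 1; 7; 7; 7; 2; 1], [:: 204; -425; 266; -94; -311; -138; 130; 196]%Z);
(10, [:: 1; 7; 0; 7; 1; 2], [:: 722; -772; -1011; -683; -643; -78; -226; -153]%Z);
(10, [:: 2; 0; 7; 7; 1; 2], [:: -890; -831; 210; 517; 232; 6; 671; -947]%Z);
(10, [:: 2; 1; 7; 7; 1; 2], [:: -1102; -615; 271; 490; -239; -622; -158; 495]%Z);
(10, [:: 1; 7; 7; 7; 1; 2], [:: 776; -262; 449; 846; 352; 143; -9; 260]%Z);
(10, [:: 2; 1; 0; 0; 2; 2], [:: 1358; -1675; 1293; 140; 752; 516; 1729; -3417]%Z);
(10, [:: 1; 7; 7; 0; 2; 2], [:: -163; 120; -286; 447; -114; -162; -466; 920]%Z);
(10, [:: 2; 0; 1; 1; 2; 2], [:: 476; -792; 1558; -43; -871; -2123; -1885; 2464]%Z);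
(10, [:: 1; 7; 7; 1; 2; 2], [:: 72; -109; -359; 524; 187; 547; 558; -597]%Z);
(12, [:: 0; 7; 7; 7; 0; 0], [:: -580; -731; -736; -1405; -293; -761; 241; -19]%Z);
(12, [:: 3; 7; 7; 7; 0; 0], [:: -111; 603; 460; 807; -61; 113; -67; 4]%Z);
(12, [:: 2; 7; 0; 7; 2; 0], [:: -1162; 227; 164; -724; 679; 725; 1604; -78]%Z);
(12, [:: 2; 7; 1; 7; 2; 0], [:: -832; 217; 12; -463; -140; -1738; -2283; -236]%Z);
(12, [:: 2; 7; 7; 7; 2; 0], [:: 1330; 323; -842; -324; -79; 119; 168; 103]%Z);
(12, [:: 3; 7; 0; 7; 3; 0], [:: -715; -324; -687; 496; -488; -792; -919; -1986]%Z);
(12, [:: 3; 7; 1; 7; 3; 0], [:: 1160; -985; 690; 953; -119; -78; 551; 102]%Z);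
(12, [:: 3; 7; 2; 7; 3; 0], [:: -246; 499; -292; 793; 316; 1298; 402; 1881]%Z);
(12, [:: 0; 7; 7; 7; 3; 0], [:: 262; 2001; 527; -601; -198; -668; -15; 1]%Z);
(12, [:: 2; 0; 7; 7; 0; 2], [:: -2113; -1194; 954; 187; -530; 148; 357; -602]%Z);
(12, [:: 2; 1; 7; 7; 0; 2], [:: -2260; -1150; 741; 496; -711; 183; -315; 831]%Z);
(12, [:: 2; 7; 7; 7; 0; 2], [:: 1127; 194; -732; 52; 345; -89; 0; -76]%Z);
(12, [:: 2; 1; 0; 0; 2; 2], [:: -501; -1208; 185; -53; -168; -669; 1716; -3030]%Z);
(12, [:: 0; 7; 7; 0; 2; 2], [:: -1752; -608; 286; 467; -443; 238; -367; 803]%Z);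
(12, [:: 2; 7; 7; 0; 2; 2], [:: 586; 95; -450; 77; 192; 152; -535; 757]%Z);
(12, [:: 2; 0; 1; 1; 2; 2], [:: -108; -1330; -192; 287; -416; 461; -1924; 3221]%Z);
(12, [:: 0; 7; 7; 1; 2; 2], [:: -1618; -654; 493; 121; -262; 162; 564; -677]%Z);
(12, [:: 2; 7; 7; 1; 2; 2], [:: 400; 149; -390; 46; 231; -183; 596; -882]%Z);
(12, [:: 2; 7; 0; 7; 2; 2], [:: 374; 14; -404; -96; 0; 136; 1551; 467]%Z);
(12, [:: 2; 7; 1; 7; 2; 2], [:: 384; 105; -302; 455; -43; 184; -1269; -425]%Z);
(12, [:: 2; 0; 7; 7; 2; 2], [:: -1362; -740; 370; 128; -198; -293; 303; -778]%Z);
(12, [:: 2; 1; 7; 7; 2; 2], [:: -1189; -796; 317; 117; -210; 81; -545; 797]%Z);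
(12, [:: 0; 7; 7; 7; 2; 2], [:: 792; -167; -427; 84; 166; -113; -52; -42]%Z);
(12, [:: 3; 0; 7; 7; 0; 3], [:: 11; -988; -962; -241; -10; -849; -1253; -1262]%Z);
(12, [:: 3; 1; 7; 7; 0; 3], [:: -648; 1126; 1691; -953; 259; 1733; -155; 234]%Z);
(12, [:: 3; 2; 7; 7; 0; 3], [:: 48; -944; -846; -578; -177; -1035; 1542; 1017]%Z);
(12, [:: 0; 7; 7; 7; 0; 3], [:: -47; 73; 346; 123; 126; 285; -59; 5]%Z);
(12, [:: 3; 1; 0; 0; 3; 3], [:: 468; 897; 2151; -478; -246; 319; 893; -282]%Z);
(12, [:: 3; 2; 1; 0; 3; 3], [:: -1926; 2397; -580; -1091; 586; 341; -5323; -2989]%Z);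
(12, [:: 0; 7; 7; 0; 3; 3], [:: -318; -1464; -55; 245; 39; 195; 1499; 1216]%Z);
(12, [:: 3; 2; 0; 1; 3; 3], [:: 670; -157; -365; -191; -521; -1645; 593; -860]%Z);
(12, [:: 3; 0; 2; 1; 3; 3], [:: 1023; 420; 76; -987; 200; -1348; 50; 671]%Z);
(12, [:: 0; 7; 7; 1; 3; 3], [:: -626; -567; 12; 198; 176; 941; -232; 14]%Z);
(12, [:: 3; 0; 1; 2; 3; 3], [:: -2114; 2045; -619; -1323; -535; -339; 3670; 2695]%Z);
(12, [:: 3; 1; 2; 2; 3; 3], [:: 786; 1412; 2553; -1274; 434; 477; 8; 772]%Z);
(12, [:: 0; 7; 7; 2; 3; 3], [:: -391; -1569; -206; 598; 132; 274; -1240; -1232]%Z);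
(14, [:: 1; 7; 0; 7; 1; 0], [:: -839; -1355; -1446; -43; 905; -658; 137; 302]%Z);
(14, [:: 3; 7; 7; 7; 1; 0], [:: 725; 647; -108; -403; -421; 90; -47; -83]%Z);
(14, [:: 3; 7; 0; 7; 3; 0], [:: 3; 323; -1228; 898; 1028; 787; 785; -957]%Z);
(14, [:: 3; 7; 1; 7; 3; 0], [:: 374; -356; 149; -390; -583; -35; -294; -42]%Z);
(14, [:: 3; 7; 2; 7; 3; 0], [:: -179; -288; -421; -684; -936; -1156; -650; 1043]%Z);
(14, [:: 1; 7; 7; 7; 3; 0], [:: 651; 126; -156; -992; -42; 70; 98; -14]%Z);
(14, [:: 1; 0; 7; 7; 0; 1], [:: 464; -124; 478; 635; -592; 144; 18; 75]%Z);
(14, [:: 3; 7; 7; 7; 0; 1], [:: 38; 221; -156; -200; 79; 118; -31; -26]%Z);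
(14, [:: 0; 7; 7; 0; 1; 1], [:: 596; -221; 480; 359; 196; -76; 266; 55]%Z);
(14, [:: 3; 7; 7; 0; 1; 1], [:: 410; -58; -77; -238; -2; 126; -51; -26]%Z);
(14, [:: 3; 7; 0; 7; 3; 1], [:: 68; 673; -42; 620; -111; -586; -4; -330]%Z);
(14, [:: 3; 7; 1; 7; 3; 1], [:: -210; -52; 106; 112; 79; -24; 269; 169]%Z);
(14, [:: 3; 7; 2; 7; 3; 1], [:: -238; -22; 37; -203; 102; 726; -152; 53]%Z);
(14, [:: 1; 0; 7; 7; 3; 1], [:: 209; -525; -195; -489; -567; 359; -220; 80]%Z);
(14, [:: 0; 7; 7; 7; 3; 1], [:: -71; -276; -205; -720; 259; 152; 53; 48]%Z);
(14, [:: 3; 0; 7; 7; 0; 3], [:: -268; -207; -352; -61; 203; -191; 48; -302]%Z);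
(14, [:: 3; 1; 7; 7; 0; 3], [:: 59; -174; 102; 156; 457; -309; 194; 271]%Z);
(14, [:: 3; 2; 7; 7; 0; 3], [:: -347; -93; 532; 255; -486; 461; -188; 82]%Z);
(14, [:: 1; 7; 7; 7; 0; 3], [:: -368; -54; -111; -135; 291; -37; 0; -18]%Z);
(14, [:: 1; 7; 0; 7; 1; 3], [:: -49; 370; 228; -49; -126; 106; -31; -75]%Z);
(14, [:: 3; 0; 7; 7; 1; 3], [:: -523; -386; -246; -115; -26; -39; 29; -83]%Z);
(14, [:: 3; 1; 7; 7; 1; 3], [:: -135; -5; 67; 374; 316; -160; -95; 113]%Z);
(14, [:: 3; 2; 7; 7; 1; 3], [:: -476; -190; -93; -76; 342; -62; 173; 77]%Z);
(14, [:: 0; 7; 7; 7; 1; 3], [:: -400; -29; -112; -66; 94; 18; -63; -13]%Z);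
(14, [:: 3; 1; 0; 0; 3; 3], [:: 89; -344; -162; -270; -90; -100; 89; 71]%Z);
(14, [:: 3; 2; 1; 0; 3; 3], [:: 22; -4; -769; -677; 327; -69; -191; -336]%Z);
(14, [:: 0; 7; 7; 0; 3; 3], [:: -83; 244; 565; 623; -513; 408; -234; 120]%Z);
(14, [:: 1; 7; 7; 0; 3; 3], [:: -169; 148; -6; 218; 442; -195; 155; 126]%Z);
(14, [:: 3; 2; 0; 1; 3; 3], [:: 345; -371; -219; -378; -234; 57; 94; -206]%Z);
(14, [:: 3; 0; 2; 1; 3; 3], [:: 198; -412; 605; -951; 16; 323; -33; 203]%Z);
(14, [:: 0; 7; 7; 1; 3; 3], [:: -273; 110; 147; 393; 201; -206; 118; 64]%Z);
(14, [:: 1; 7; 7; 1; 3; 3], [:: -491; 271; 114; 545; 266; -117; -85; -90]%Z);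
(14, [:: 3; 0; 1; 2; 3; 3], [:: 153; 489; -338; 175; 95; 304; -64; 51]%Z);
(14, [:: 3; 1; 2; 2; 3; 3], [:: -40; -350; 611; -776; 200; 133; 4; 394]%Z);
(14, [:: 0; 7; 7; 2; 3; 3], [:: 15; 166; -332; 374; 125; -309; 1; -281]%Z);
(14, [:: 1; 7; 7; 2; 3; 3], [:: -198; -13; -214; 261; 115; -163; 59; -103]%Z);
(18, [:: 2; 1; 0; 0; 2; 2], [:: 483; 289; -169; 274; -889; -22; -90; -946]%Z);
(18, [:: 3; 7; 7; 0; 2; 2], [:: 112; 122; 37; -71; 59; 91; -106; 237]%Z);
(18, [:: 2; 0; 1; 1; 2; 2], [:: 370; -567; 367; 696; -55; -51; -682; 1093]%Z);
(18, [:: 3; 7; 7; 1; 2; 2], [:: 163; 343; -71; -167; -166; 74; 73; -287]%Z);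
(18, [:: 3; 7; 0; 7; 3; 2], [:: 13; -376; 69; 368; -417; 29; -288; 319]%Z);
(18, [:: 3; 7; 1; 7; 3; 2], [:: -71; -223; 180; 314; -259; 140; 65; -380]%Z);
(18, [:: 3; 7; 2; 7; 3; 2], [:: 225; 40; -106; -121; 21; 247; -431; 11]%Z);
(18, [:: 2; 0; 7; 7; 3; 2], [:: -488; -102; 147; -278; -156; -107; 185; -220]%Z);
(18, [:: 2; 1; 7; 7; 3; 2], [:: -502; -312; 297; -167; 41; -129; 55; 282]%Z);
(18, [:: 2; 7; 0; 7; 2; 3], [:: 35; -88; 351; 22; 119; -292; 442; 79]%Z);
(18, [:: 2; 7; 1; 7; 2; 3], [:: -473; -41; -402; -283; 305; 285; -129; -113]%Z);
(18, [:: 3; 0; 7; 7; 2; 3], [:: -38; -170; -104; 549; 283; -270; 7; -75]%Z);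
(18, [:: 3; 1; 7; 7; 2; 3], [:: -155; -176; 51; -289; -209; 112; -103; 66]%Z);
(18, [:: 3; 2; 7; 7; 2; 3], [:: -129; -171; 120; -54; 58; 33; 157; 58]%Z);
(18, [:: 3; 1; 0; 0; 3; 3], [:: -32; -53; 317; -429; 351; -134; 609; -422]%Z);
(18, [:: 3; 2; 1; 0; 3; 3], [:: 138; 266; -403; 522; 199; -526; -528; 452]%Z);
(18, [:: 2; 7; 7; 0; 3; 3], [:: 253; 163; 62; -100; -50; 230; 56; -30]%Z);
(18, [:: 3; 2; 0; 1; 3; 3], [:: -702; -139; -29; -59; 658; -330; 561; -231]%Z);
(18, [:: 3; 0; 2; 1; 3; 3], [:: -768; 105; -99; 59; -64; -148; 298; -77]%Z);
(18, [:: 2; 7; 7; 1; 3; 3], [:: 356; 66; -326; 13; 7; 125; -202; 122]%Z);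
(18, [:: 3; 0; 1; 2; 3; 3], [:: -58; 65; 321; -1436; 243; 226; 156; 682]%Z);
(18, [:: 3; 1; 2; 2; 3; 3], [:: -107; 162; 242; -221; -391; 8; 341; -253]%Z);
(18, [:: 2; 7; 7; 2; 3; 3], [:: 336; 134; -144; 500; 185; -80; -69; -154]%Z);
(20, [:: 4; 7; 7; 7; 0; 0], [:: 183; 566; -144; -6; 195; 158; 130; -32]%Z);
(20, [:: 4; 7; 0; 7; 4; 0], [:: -595; 396; -2; 525; 394; 510; 1348; -1311]%Z);
(20, [:: 4; 7; 1; 7; 4; 0], [:: 883; 222; 22; 87; 326; 77; 250; -1355]%Z);
(20, [:: 4; 7; 2; 7; 4; 0], [:: 937; 259; -403; 14; 531; 795; 573; 1307]%Z);
(20, [:: 4; 7; 3; 7; 4; 0], [:: -196; 391; -96; -232; -151; -553; -1377; 1128]%Z);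
(20, [:: 0; 7; 7; 7; 4; 0], [:: 566; 774; 535; -59; -692; -230; -594; 263]%Z);
(20, [:: 4; 0; 7; 7; 0; 4], [:: -17; -599; -48; -369; -19; 217; -974; -431]%Z);
(20, [:: 4; 1; 7; 7; 0; 4], [:: -328; 256; 158; 86; 474; -531; 540; -337]%Z);
(20, [:: 4; 2; 7; 7; 0; 4], [:: -484; 183; 440; 177; 135; 8; 128; 195]%Z);
(20, [:: 4; 3; 7; 7; 0; 4], [:: 28; -577; -249; -153; -493; -44; 135; 602]%Z);
(20, [:: 0; 7; 7; 7; 0; 4], [:: -244; -253; 77; -68; 33; -98; -37; 3]%Z);
(20, [:: 4; 1; 0; 0; 4; 4], [:: 397; -266; 615; 42; 901; -455; -613; -84]%Z);
(20, [:: 4; 2; 1; 0; 4; 4], [:: -39; -216; 457; -239; -92; -30; -366; -555]%Z);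
(20, [:: 4; 3; 2; 0; 4; 4], [:: -982; 968; -488; -49; -233; 216; -213; -293]%Z);
(20, [:: 0; 7; 7; 0; 4; 4], [:: -37; -432; -305; -18; -138; -46; 642; 506]%Z);
(20, [:: 4; 2; 0; 1; 4; 4], [:: -116; 558; -85; 464; 896; -1426; 973; 33]%Z);
(20, [:: 4; 3; 1; 1; 4; 4], [:: -383; -616; 248; -505; -413; 239; -1042; -486]%Z);
(20, [:: 4; 0; 3; 1; 4; 4], [:: 408; -544; -143; -558; -661; 499; -159; 210]%Z);
(20, [:: 0; 7; 7; 1; 4; 4], [:: -598; -66; 146; 51; 187; 215; -15; 192]%Z);
(20, [:: 4; 3; 0; 2; 4; 4], [:: 35; -594; 361; -220; 555; -181; -1259; -158]%Z);
(20, [:: 4; 0; 2; 2; 4; 4], [:: -624; -690; 589; 41; -138; -1109; -414; 433]%Z);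
(20, [:: 4; 1; 3; 2; 4; 4], [:: 190; 537; -359; -233; -1258; 1601; 636; 399]%Z);
(20, [:: 0; 7; 7; 2; 4; 4], [:: -435; 9; -142; -59; 492; -254; 355; -399]%Z);
(20, [:: 4; 0; 1; 3; 4; 4], [:: -976; 1038; -765; 101; -389; 422; 186; 635]%Z);
(20, [:: 4; 1; 2; 3; 4; 4], [:: -319; -293; 819; 362; 278; -1342; 359; 362]%Z);
(20, [:: 4; 2; 3; 3; 4; 4], [:: 747; -213; 137; -260; -238; 218; 556; -29]%Z);
(20, [:: 0; 7; 7; 3; 4; 4], [:: -114; -456; -77; -180; 442; 123; -428; -566]%Z);
(22, [:: 4; 7; 7; 0; 1; 1], [:: 321; -341; 112; 19; -138; 115; 72; 24]%Z);
(22, [:: 4; 7; 0; 7; 4; 1], [:: -410; -69; 425; 719; -507; 27; 95; 115]%Z);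
(22, [:: 4; 7; 1; 7; 4; 1], [:: -249; 266; -24; -64; -204; 422; 88; 340]%Z);
(22, [:: 4; 7; 2; 7; 4; 1], [:: 35; -69; 170; 196; -211; 313; 179; -73]%Z);
(22, [:: 4; 7; 3; 7; 4; 1], [:: -375; 351; -64; -184; 198; -101; 113; -213]%Z);
(22, [:: 1; 0; 7; 7; 4; 1], [:: -563; 333; 19; -52; 200; -399; -461; -193]%Z);
(22, [:: 1; 7; 0; 7; 1; 4], [:: -66; 1; 156; -5; 81; -28; -12; -2]%Z);
(22, [:: 4; 0; 7; 7; 1; 4], [:: 31; 64; 129; -222; 428; -125; -273; 289]%Z);
(22, [:: 4; 1; 7; 7; 1; 4], [:: -175; 4; 124; 66; -94; 128; 27; -117]%Z);
(22, [:: 4; 2; 7; 7; 1; 4], [:: -112; -119; 270; -7; -225; 27; 16; -253]%Z);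
(22, [:: 4; 3; 7; 7; 1; 4], [:: 21; 19; 78; 143; 180; -148; 150; 59]%Z);
(22, [:: 4; 1; 0; 0; 4; 4], [:: 100; -165; 213; 250; -202; 110; -170; -157]%Z);
(22, [:: 4; 2; 1; 0; 4; 4], [:: -58; 356; -582; 35; -324; -357; 38; 62]%Z);
(22, [:: 4; 3; 2; 0; 4; 4], [:: 310; -375; 935; -589; 869; 178; -495; -1]%Z);
(22, [:: 1; 7; 7; 0; 4; 4], [:: 197; -87; -29; 147; -95; 34; 341; 26]%Z);
(22, [:: 4; 2; 0; 1; 4; 4], [:: 123; -250; 456; -474; 329; -3; -137; -261]%Z);
(22, [:: 4; 3; 1; 1; 4; 4], [:: -478; 227; -330; 81; 44; -470; -82; 236]%Z);
(22, [:: 4; 0; 3; 1; 4; 4], [:: 89; -112; 11; 138; 231; 187; -4; 288]%Z);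
(22, [:: 1; 7; 7; 1; 4; 4], [:: 167; -353; 417; 9; -103; 116; 90; -110]%Z);
(22, [:: 4; 3; 0; 2; 4; 4], [:: 25; -270; 464; 234; 195; -9; -290; 41]%Z);
(22, [:: 4; 0; 2; 2; 4; 4], [:: -227; -224; 213; 438; 37; -206; -66; -187]%Z);
(22, [:: 4; 1; 3; 2; 4; 4], [:: 51; 130; -258; -1078; 123; -257; 108; 160]%Z);
(22, [:: 1; 7; 7; 2; 4; 4], [:: 79; -198; 237; 66; 12; 190; 112; 45]%Z);
(22, [:: 4; 0; 1; 3; 4; 4], [:: -22; -129; 676; -191; 374; -332; 71; -277]%Z);
(22, [:: 4; 1; 2; 3; 4; 4], [:: 217; -154; 32; 449; -355; -85; 31; -378]%Z);
(22, [:: 4; 2; 3; 3; 4; 4], [:: 138; -3; -227; 183; -191; 308; 97; 133]%Z);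
(22, [:: 1; 7; 7; 3; 4; 4], [:: 206; -68; 69; -170; 136; 56; -91; 233]%Z);
(30, [:: 5; 7; 0; 7; 5; 0], [:: 362; -429; -356; 2; -128; 391; 250; -459]%Z);
(30, [:: 5; 7; 1; 7; 5; 0], [:: 552; 62; -30; 132; 13; 28; -116; -107]%Z);
(30, [:: 5; 7; 2; 7; 5; 0], [:: 251; -158; -490; 165; 421; 272; 94; -245]%Z);
(30, [:: 5; 7; 3; 7; 5; 0], [:: 396; -260; 196; 120; -504; 19; -119; 173]%Z);
(30, [:: 5; 7; 4; 7; 5; 0], [:: 5; 49; -159; 248; 71; -309; -423; 641]%Z);
(30, [:: 5; 0; 7; 7; 0; 5], [:: -68; -289; 33; -203; -362; -19; -70; -55]%Z);
(30, [:: 5; 1; 7; 7; 0; 5], [:: -352; 87; 114; -205; 318; 97; -14; -157]%Z);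
(30, [:: 5; 2; 7; 7; 0; 5], [:: -115; -5; -253; 250; 27; -312; 129; -49]%Z);
(30, [:: 5; 3; 7; 7; 0; 5], [:: -81; 238; 113; -65; -116; 38; 92; -66]%Z);
(30, [:: 5; 4; 7; 7; 0; 5], [:: 33; -136; 175; -333; -143; 109; -64; 327]%Z);
(30, [:: 5; 1; 0; 0; 5; 5], [:: 189; -265; -38; 53; -102; -431; -2; 29]%Z);
(30, [:: 5; 2; 1; 0; 5; 5], [:: -170; -15; -345; 262; -183; -90; -128; -180]%Z);
(30, [:: 5; 3; 2; 0; 5; 5], [:: -106; 88; 316; -110; -4; 160; 286; 354]%Z);
(30, [:: 5; 4; 3; 0; 5; 5], [:: -272; 379; -67; -302; 128; 211; -82; -465]%Z);
(30, [:: 0; 7; 7; 0; 5; 5], [:: -338; -73; 296; -188; -61; 152; 8; 266]%Z);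
(30, [:: 5; 2; 0; 1; 5; 5], [:: 49; -304; -280; -216; 353; -463; 96; -387]%Z);
(30, [:: 5; 3; 1; 1; 5; 5], [:: -15; -259; 357; 111; -122; 90; -58; -141]%Z);
(30, [:: 5; 4; 2; 1; 5; 5], [:: -206; -9; 28; -271; -177; 36; 218; 443]%Z);
(30, [:: 5; 0; 4; 1; 5; 5], [:: -277; 177; 58; -16; -178; 270; -290; 146]%Z);
(30, [:: 0; 7; 7; 1; 5; 5], [:: 127; 201; -31; -94; -184; -58; 89; -25]%Z);
(30, [:: 5; 3; 0; 2; 5; 5], [:: 18; -288; 6; -404; 395; -204; -19; -353]%Z);
(30, [:: 5; 4; 1; 2; 5; 5], [:: -302; -97; -346; -87; -316; 45; -311; -57]%Z);
(30, [:: 5; 0; 3; 2; 5; 5], [:: -47; -342; 139; -155; -75; -282; 38; 286]%Z);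
(30, [:: 5; 1; 4; 2; 5; 5], [:: -99; 269; 488; -203; -295; 632; 251; 160]%Z);
(30, [:: 0; 7; 7; 2; 5; 5], [:: 200; -28; -134; 34; 2; -139; 4; 5]%Z);
(30, [:: 5; 4; 0; 3; 5; 5], [:: -43; -332; -360; -128; -258; -531; -76; 83]%Z);
(30, [:: 5; 0; 2; 3; 5; 5], [:: -74; -70; -112; -50; -328; -260; -355; -215]%Z);
(30, [:: 5; 1; 3; 3; 5; 5], [:: 2; -89; 418; -53; 382; 291; 110; 119]%Z);
(30, [:: 5; 2; 4; 3; 5; 5], [:: -75; 266; 176; -24; -335; 384; 382; 143]%Z);
(30, [:: 0; 7; 7; 3; 5; 5], [:: -153; 64; -68; -232; 213; 10; -24; -118]%Z);
(30, [:: 5; 0; 1; 4; 5; 5], [:: -353; 396; -639; -675; 150; 231; 348; 226]%Z);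
(30, [:: 5; 1; 2; 4; 5; 5], [:: 54; -30; 174; 98; -146; -177; -265; -339]%Z);
(30, [:: 5; 2; 3; 4; 5; 5], [:: 103; -304; 111; 174; 66; -448; 260; 145]%Z);
(30, [:: 5; 3; 4; 4; 5; 5], [:: -36; 211; 317; 157; -6; 342; -234; 6]%Z);
(30, [:: 0; 7; 7; 4; 5; 5], [:: -419; -269; 117; -76; -244; -53; -4; -127]%Z);
(42, [:: 6; 1; 0; 0; 6; 6], [:: -148; 101; -202; -118; -10; -364; 137; 116]%Z);
(42, [:: 6; 2; 1; 0; 6; 6], [:: -345; 201; -29; -61; -309; -92; 66; 86]%Z);
(42, [:: 6; 3; 2; 0; 6; 6], [:: -98; 141; 162; -53; 4; 127; 52; -27]%Z);
(42, [:: 6; 4; 3; 0; 6; 6], [:: -70; 3; -94; -164; -290; -339; -7; -228]%Z);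
(42, [:: 6; 5; 4; 0; 6; 6], [:: 33; -457; 329; 264; 655; 628; -212; 5]%Z);
(42, [:: 6; 2; 0; 1; 6; 6], [:: 40; -287; -17; 262; -29; 119; 205; 206]%Z);
(42, [:: 6; 3; 1; 1; 6; 6], [:: 37; 34; -74; 227; -143; 17; 24; 49]%Z);
(42, [:: 6; 4; 2; 1; 6; 6], [:: 182; -287; -199; 60; 359; -90; 201; 3]%Z);
(42, [:: 6; 5; 3; 1; 6; 6], [:: 132; -3; -143; -205; -189; -271; -115; -238]%Z);
(42, [:: 6; 0; 5; 1; 6; 6], [:: -76; 283; 149; 13; 139; 227; -329; -64]%Z);
(42, [:: 6; 3; 0; 2; 6; 6], [:: 158; -164; -220; 14; -266; 53; 178; 135]%Z);
(42, [:: 6; 4; 1; 2; 6; 6], [:: -182; 13; 24; 239; -114; -48; -24; 134]%Z);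
(42, [:: 6; 5; 2; 2; 6; 6], [:: -131; 117; 230; -69; 137; 138; -107; 49]%Z);
(42, [:: 6; 0; 4; 2; 6; 6], [:: 10; 99; -39; -134; 254; -266; -23; -201]%Z);
(42, [:: 6; 1; 5; 2; 6; 6], [:: -6; -135; 69; -83; 103; 72; -75; -89]%Z);
(42, [:: 6; 4; 0; 3; 6; 6], [:: -33; -307; 93; 300; 2; 61; 157; 286]%Z);
(42, [:: 6; 5; 1; 3; 6; 6], [:: -215; 175; 33; -63; -177; -83; -90; 155]%Z);
(42, [:: 6; 0; 3; 3; 6; 6], [:: -211; 52; -59; -218; 197; 187; -68; 174]%Z);
(42, [:: 6; 1; 4; 3; 6; 6], [:: 115; 40; -66; -63; 17; 26; 43; -35]%Z);
(42, [:: 6; 2; 5; 3; 6; 6], [:: 194; -35; 80; 53; 103; -221; -85; -548]%Z);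
(42, [:: 6; 5; 0; 4; 6; 6], [:: -277; 68; -229; -129; 71; -273; 24; 135]%Z);
(42, [:: 6; 0; 2; 4; 6; 6], [:: 40; -68; -19; 316; -6; 43; -85; -3]%Z);
(42, [:: 6; 1; 3; 4; 6; 6], [:: 141; -205; 188; 396; 2; 30; -25; 131]%Z);
(42, [:: 6; 2; 4; 4; 6; 6], [:: 312; 66; -183; -111; -58; 69; 90; -102]%Z);
(42, [:: 6; 3; 5; 4; 6; 6], [:: 45; -113; -30; -105; 50; 116; -23; -155]%Z);
(42, [:: 6; 0; 1; 5; 6; 6], [:: -209; -443; 214; -191; -69; -31; -32; 155]%Z);
(42, [:: 6; 1; 2; 5; 6; 6], [:: -148; -80; 1; 350; -90; -28; 51; 20]%Z);
(42, [:: 6; 2; 3; 5; 6; 6], [:: -186; 62; -145; -211; 41; 136; 112; 115]%Z);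
(42, [:: 6; 3; 4; 5; 6; 6], [:: -127; 108; -119; -123; 118; -292; 163; -242]%Z);
(42, [:: 6; 4; 5; 5; 6; 6], [:: 23; 303; 171; 59; 20; 142; -200; -20]%Z)].

(** Keys are formed as in [pointed_type], with the same digit order and the same shift of the rank
    to a positive number. *)
Definition certificate_map : PM.t (seq Z) :=
  foldr (fun e M => let: (r, d, v) := e in
           PM.add (digits (Pos.of_succ_nat r) d) v M) (PM.empty _) certificate.

(* The constant is the largest one for which the first half of [check_pair] holds. *)
Lemma check_certificate : check certificate_map 399999760.
Proof. by vm_cast_no_check (erefl true). Qed.

Theorem mainTheorem3 : M 7 4 <= 535.
Proof.
by apply/M_leP => Gamma codeG; apply: (card_code_le check_certificate) codeG.
Qed.
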